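(* Let $d$ and $k$ be integers with $2\leq k\leq \lfloor d/2\rfloor$. Let $\lambda(d,k)$ be the smallest integer such that for every set $X$ of $\lambda(d,k)$ points in $\mathbb{R}^d$ there exists a partition of $X$ into two sets $A,B$ such that \[ \mathrm{conv}(A\setminus\{x_1,\dots,x_k\})\cap \mathrm{conv}(B\setminus\{x_1,\dots,x_k\})\neq\emptyset \] for every $k$-element subset $\{x_1,\dots,x_k\}\subset X$. Then \[ 2d+k+1\leq \lambda(d,k)\leq (k+1)d+(k+2). \]
   Formalization: λ(d,k) is taken as the smallest integer that is at least k with the stated property, since sets X with fewer than k points have no k-element subset and satisfy the condition vacuously, which would make the literal minimum 0. *)

(* Defs.v *)
From HB Require Import structures.
From mathcomp Require Import all_boot all_order all_algebra finmap.
From mathcomp Require Import boolp classical_sets reals convex.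

Set Implicit Arguments.
Unset Strict Implicit.
Unset Printing Implicit Defensive.

Local Open Scope classical_set_scope.

Definition conv_hull (R : realType) (d : nat) (S : set 'rV[R]_d) :
    set 'rV[R]_d :=
  smallest (@convex_set R 'rV[R]_d) S.

(* The parts A and B are not required to be nonempty: as soon as X has a
   k-element subset, the last condition forces this. *)
Definition tolerant_partition (R : realType) (d k : nat)
    (X A B : {fset 'rV[R]_d}) : Prop :=
  [/\ (A `|` B)%fset = X, (A `&` B)%fset = fset0
    & forall S : {fset 'rV[R]_d}, (S `<=` X)%fset -> #|` S|%fset = k ->
        conv_hull [set` (A `\` S)%fset] `&` conv_hull [set` (B `\` S)%fset]
          !=set0].

(* A set with fewer than k points has no k-element subset and satisfies the
   partition condition vacuously; k <= n discards these degenerate sizes. *)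
Definition lambda_spec (R : realType) (d k n : nat) : Prop :=
  (k <= n)%N /\
  forall X : {fset 'rV[R]_d}, #|` X|%fset = n ->
    exists A B : {fset 'rV[R]_d}, tolerant_partition k X A B.

Definition is_lambda (R : realType) (d k n : nat) : Prop :=
  lambda_spec R d k n /\ forall m : nat, lambda_spec R d k m -> (n <= m)%N.

(* The default value 0, taken if no n satisfies lambda_spec, violates every
   positive lower bound, so such a bound on lambda includes its existence. *)
Definition lambda (R : realType) (d k : nat) : nat :=
  xget 0%N [set n | is_lambda R d k n].

(* Main.v *)
Require Import Defs.
From mathcomp Require Import all_boot all_order all_algebra reals.
From mathcomp Require Import finmap boolp classical_sets interval_inference.
From mathcomp Require Import topology normedtype derive convex.
From mathcomp Require Import zify ring lra.

(* Lifting x to (1, x) turns a partition into a choice of signs, and tolerance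
   k means that after deleting any k vectors the signed rest still has 0 in its
   convex hull.

   Upper bound: for (k + 1) n + 1 vectors in R^n, n >= 2, such signs exist, by
   induction on k and a distance-decreasing argument (see [tolerant_signs]).

   Lower bound: put 2 d + k points on a rapidly growing curve whose coordinates
   carry prescribed signs.  A hyperplane then sees, at the j-th point, the sign
   of a single coordinate r j, where r may be any nondecreasing function and
   the sign of every coordinate may be flipped at will.  The i-th sign sequence
   alternates up to time 2 i + 1 and is constant afterwards; with these
   sequences every 2-colouring of the first 2 d + 2 points is followed by some
   r with at most two errors, so that every partition is destroyed by deleting
   these errors and the last k - 2 points. *)

Set Implicit Arguments.
Unset Strict Implicit.
Unset Printing Implicit Defensive.
Import Order.TTheory GRing.Theory Num.Theory.
Import numFieldNormedType.Exports.

(** * Following a 2-colouring by a staircase *)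

Definition row_sign (i j : nat) : bool := odd (minn j i.*2.+1).

(** [e] is the colouring to be followed; [s i] flips row [i] at all times at once. *)
Definition mismatch (e : nat -> bool) (r : nat -> nat) (s : nat -> bool)
  (j : nat) : bool := row_sign (r j) j (+) s (r j) (+) e j.

(** The last error bit [b] is recorded because, together with [e j], it determines the flip of the
    current row [i], hence the error made by staying there. *)
Definition reach (e : nat -> bool) (j i : nat) (b : bool) (q : nat) : Prop :=
  exists r s,
    [/\ forall x y, x <= y <= j -> r x <= r y, r j = i, mismatch e r s j = b
      & \sum_(l < j.+1) mismatch e r s l <= q].

Lemma reach_start e i b : reach e 0 i b b.
Proof.
exists (fun=> i), (fun=> row_sign i 0 (+) e 0 (+) b); split=> //.
  by rewrite /mismatch; case: row_sign (e 0) b => [] [] [].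
by rewrite big_ord_recl big_ord0 addn0 /mismatch; case: row_sign (e 0) b => [] [] [].
Qed.

Lemma reach_leq e j i b q q' : reach e j i b q -> q <= q' -> reach e j i b q'.
Proof.
by move=> [r [s [? ? ? h]]] hq; exists r, s; split=> //; apply: leq_trans hq.
Qed.

Lemma row_signS i j : row_sign i j.+1 = row_sign i j (+) (j < i.*2.+1).
Proof.
rewrite /row_sign; have [h|h] := boolP (j < i.*2.+1).
  have -> : minn j.+1 i.*2.+1 = (minn j i.*2.+1).+1 by lia.
  by rewrite /= addbT.
by rewrite addbF; congr odd; lia.
Qed.

(** By monotonicity a row [i' > i] has not been visited yet, so its flip [f] is free; when staying,
    [f] must be the flip already in use, recovered from [b]. *)
Lemma reach_extend e j i b q i' (f : bool) :
  reach e j i b q -> i <= i' ->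
  (i < i' \/ f = row_sign i j (+) b (+) e j) ->
  reach e j.+1 i' (row_sign i' j.+1 (+) f (+) e j.+1)
    (q + (row_sign i' j.+1 (+) f (+) e j.+1)).
Proof.
move=> [r [s [rmono rj sj hq]]] ii' hf.
pose r' x := if x <= j then r x else i'.
pose s'' x := if x == i' then f else s x.
have r'S : r' j.+1 = i' by rewrite /r' ltnn.
have same l : l <= j -> mismatch e r' s'' l = mismatch e r s l.
  move=> lj; rewrite /mismatch /r' /s'' lj; case: eqP => // rl.
  case: hf => [lt_ii'|->]; first by have := rmono l j; rewrite lj leqnn rj rl; lia.
  have ei : i' = i by apply/eqP; rewrite eqn_leq ii' -rl -rj rmono ?lj ?leqnn.
  rewrite rl ei -sj /mismatch rj.
  by case: (row_sign i j) (row_sign i l) (s i) (e j) (e l) => [] [] [] [] [].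
have last : mismatch e r' s'' j.+1 = row_sign i' j.+1 (+) f (+) e j.+1.
  by rewrite /mismatch r'S /s'' eqxx.
exists r', s''; split=> //.
  move=> x y /andP[xy yj]; rewrite /r'; case: (leqP y j) => hy.
    by rewrite (leq_trans xy hy); apply: rmono; rewrite xy.
  case: (leqP x j) => // hx; apply: leq_trans ii'.
  by rewrite -rj; apply: rmono; rewrite hx leqnn.
rewrite big_ord_recr /= last leq_add2r; apply: leq_trans hq.
by apply: eq_leq; apply: eq_bigr => l _; rewrite same // -ltnS.
Qed.

Lemma reach_move e j i b q i' b' : reach e j i b q -> i < i' ->
  reach e j.+1 i' b' (q + b').
Proof.
move=> h ii'.
have := @reach_extend e j i b q i' (row_sign i' j.+1 (+) b' (+) e j.+1) h
  (ltnW ii') (or_introl ii').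
set b1 := (_ (+) _ (+) e j.+1); have -> // : b1 = b'.
by rewrite /b1 {b1}; case: row_sign (e _) b' => [] [] [].
Qed.

Lemma reach_stay e j i b q : reach e j i b q ->
  let b' := b (+) (j < i.*2.+1) (+) (e j (+) e j.+1) in
  reach e j.+1 i b' (q + b').
Proof.
move=> h b'.
have := @reach_extend e j i b q i _ h (leqnn i) (or_intror erefl).
set b1 := (_ (+) _ (+) e j.+1); have -> // : b1 = b'.
rewrite /b1 /b' row_signS {b' b1}; move: (j < _) => c.
by case: row_sign c (e _) (e _) b {h} => [] [] [] [] [].
Qed.

(* Invariant of the walk.  At time [j], row [i] lies on the constant side
   ([Good]) or on the alternating side ([Bad]) of its break [2 i + 1].  A walker
   without errors bounces off the break line and changes side each time; while
   it is on the wrong side, a second walker [i'], which branched off at the last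
   change of side, mirrors it on the good side with at most two errors. *)
Inductive walkers (e : nat -> bool) (j : nat) : Prop :=
| Good i h of j = i.*2.+1 + h & reach e j i false 0
| Bad0 i i' of i.*2 = j & reach e j i false 0
    & j = i'.*2.+2 & reach e j i' true 1
| Bad1 i i' g of i.*2 = j + g.+1 & reach e j i false 0
    & i'.*2 + g.+1 = j & reach e j i' false 1 & (g = 0 -> reach e j i' true 2)
| Bad2 i i' g of i.*2 = j + g & reach e j i false 0
    & i'.*2.+2 + g = j & reach e j i' false 2.

(** The error-free walker stays when its row sign changes exactly if the colour does, and otherwise
    enters the next row with a fresh flip. Staying changes [j - (2 i + 1)] by 1, moving by -1. *)
Lemma walkersP e j : walkers e j.+1.
Proof.
elim: j => [|j].
  have h0 := reach_stay (reach_start e 0 false).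
  have h1 := reach_stay (reach_start e 0 true).
  move: h0 h1 => /=; case: (e 0 (+) e 1) => /= h0 h1.
    by apply: (@Good _ _ 0 0).
  apply: (@Bad1 _ _ 1 0 0) => //.
    exact: reach_move (reach_start e 0 false) (ltn0Sn 0).
  by move=> _; apply: reach_leq h0 _.
have stay i b q b' : reach e j.+1 i b q ->
    b (+) (j.+1 < i.*2.+1) (+) (e j.+1 (+) e j.+2) = b' -> reach e j.+2 i b' (q + b').
  by move=> h <-; apply: reach_stay.
have move1 i b q b' : reach e j.+1 i b q -> reach e j.+2 i.+1 b' (q + b').
  by move=> h; apply: reach_move h _.
case eE: (e j.+1 (+) e j.+2) stay => stay.
- case=> [i [|h] hj hr|i i' hi hr hi' hr'|i i' g hi hr hi' hr' hr2|i i' g hi hr hi' hr'].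
  + apply: (@Bad0 _ _ i.+1 i); [lia|exact: move1 hr|lia|].
    by apply: stay hr _; lia.
  + apply: (@Good _ _ i.+1 h); [lia|exact: move1 hr].
  + apply: (@Good _ _ i 0); [lia|apply: stay hr _; lia].
  (* At [g = 0] the second walker is at its break and would change side by moving. It stays instead,
     with the flip that is wrong at the current time: this second error makes it right after the
     colour change. *)
  + case: g hi hi' hr2 => [|g] hi hi' hr2.
      apply: (@Bad2 _ _ i i' 0); [lia|apply: stay hr _; lia|lia|].
      by apply: stay (hr2 erefl) _; lia.
    apply: (@Bad1 _ _ i i'.+1 g); [lia|apply: stay hr _; lia|lia| |].
      exact: move1 hr'.
    by move=> _; exact: move1 hr'.
  + case: g hi hi' => [|g] hi hi'.
      by apply: (@Good _ _ i 0); [lia|apply: stay hr _; lia].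
    apply: (@Bad2 _ _ i i'.+1 g); [lia|apply: stay hr _; lia|lia|].
    exact: move1 hr'.
- case=> [i h hj hr|i i' hi hr hi' hr'|i i' g hi hr hi' hr' hr2|i i' g hi hr hi' hr'].
  + apply: (@Good _ _ i h.+1); [lia|apply: stay hr _; lia].
  + apply: (@Bad1 _ _ i.+1 i'.+1 0); [lia|exact: move1 hr|lia|exact: move1 hr'|].
    by move=> _; exact: move1 hr'.
  + apply: (@Bad1 _ _ i.+1 i' g.+1); [lia|exact: move1 hr|lia| |by []].
    by apply: stay hr' _; lia.
  + apply: (@Bad2 _ _ i.+1 i' g.+1); [lia|exact: move1 hr|lia|].
    by apply: stay hr' _; lia.
Qed.

(** At time [2 d + 1] a row on the constant side of its break has index at most [d], so the walker
    on that side is taken; later times keep its last row. *)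
Lemma staircase_exists (e : nat -> bool) (d : nat) : exists r s,
  [/\ {homo r : x y / x <= y}, forall j, r j <= d
    & \sum_(j < d.*2.+2) mismatch e r s j <= 2].
Proof.
have [i [b hi [r [s [rmono ri _ hq]]]]] :
    exists i, exists2 b, i <= d & reach e d.*2.+1 i b 2.
  case: (walkersP e d.*2) => [i h ? hr|i i' ? _ ? hr|i i' g ? _ ? hr _|i i' g ? _ ? hr].
  - by exists i, false; [lia|apply: reach_leq hr _].
  - by exists i', true; [lia|apply: reach_leq hr _].
  - by exists i', false; [lia|apply: reach_leq hr _].
  - by exists i', false; [lia|].
exists (fun j => r (minn j d.*2.+1)), s; split.
- by move=> x y xy; apply: rmono; lia.
- by move=> j; apply: leq_trans hi; rewrite -ri; apply: rmono; lia.
- apply: leq_trans hq; apply: eq_leq; apply: eq_bigr => j _.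
  by rewrite /mismatch; have -> : minn j d.*2.+1 = j by have := ltn_ord j; lia.
Qed.

Local Open Scope ring_scope.

(* Row weights [base ^- breaks] make row [r j] dominate at time [j]: the slope
   of [breaks] between rows i and i + 1 is twice the number of times spent in
   rows up to i. *)
Definition breaks (m : nat) (r : nat -> nat) (i : nat) : nat :=
  (\sum_(j < m) (i - r j)).*2.

(** The exponent [(2 j + 1) i - breaks m r i] has slope [2 j + 1 - 2 c] at [i], where [c] counts the
    times spent in rows up to [i]. As [r] is nondecreasing, [c <= j] below row [r j] and
    [c >= j + 1] from it on, so the maximum is attained at [r j] only. *)
Lemma breaks_gap (m : nat) (r : nat -> nat) (i j : nat) :
  {homo r : x y / (x <= y)%N} -> (j < m)%N -> i != r j ->
  ((j.*2.+1 * i + breaks m r (r j)).+1 <= j.*2.+1 * r j + breaks m r i)%N.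
Proof.
move=> rmono jm; rewrite /breaks neq_ltn => /orP[lt_i|lt_i].
  suff : (\sum_(l < m) (r j - r l) <= \sum_(l < m) (i - r l) + j * (r j - i))%N by nia.
  have -> : (j * (r j - i) = \sum_(l < m | (l < j)%N) (r j - i))%N.
    by rewrite -(big_ord_widen _ (fun=> r j - i)%N (ltnW jm)) sum_nat_const card_ord.
  rewrite [X in (_ <= _ + X)%N]big_mkcond /=.
  rewrite -big_split /=; apply: leq_sum => l _; case: ltnP => h; first by lia.
  by have := rmono _ _ h; lia.
suff : (\sum_(l < m) (r j - r l) + j.+1 * (i - r j) <= \sum_(l < m) (i - r l))%N by nia.
have -> : (j.+1 * (i - r j) = \sum_(l < m | (l < j.+1)%N) (i - r j))%N.
  by rewrite -(big_ord_widen _ (fun=> i - r j)%N jm) sum_nat_const card_ord.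
rewrite [X in (_ + X <= _)%N]big_mkcond /=.
rewrite -big_split /=; apply: leq_sum => l _; case: ltnP => h; last by lia.
by have := rmono l j; lia.
Qed.

(** * The curve and the lower bound *)

Section Curve.
Variables (R : realType) (d : nat).

Definition base : R := d.+2%:R.

Lemma base_gt1 : 1 < base. Proof. by rewrite /base ltr1n. Qed.
Lemma base_gt0 : 0 < base. Proof. by rewrite /base ltr0n. Qed.

(* The factor [row_sign 0] normalizes the coordinate of row 0 to 1. *)
Definition curve (j : nat) : 'rV[R]_d :=
  \row_(i < d) ((-1) ^+ row_sign 0 j * (-1) ^+ row_sign i.+1 j
                 * base ^+ (j.*2.+1 * i.+1)).

Definition affine_form (w : nat -> R) (x : 'rV[R]_d) : R :=
  w 0%N + \sum_(i < d) w i.+1 * x 0 i.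

Lemma affine_form_curve (w : nat -> R) j :
  affine_form w (curve j) = (-1) ^+ row_sign 0 j *
    \sum_(i < d.+1) w i * (-1) ^+ row_sign i j * base ^+ (j.*2.+1 * i).
Proof.
rewrite /affine_form big_ord_recl muln0 expr0 mulr1 mulrDr mulrCA -signr_addb.
rewrite addbb expr0 mulr1; congr (_ + _); rewrite mulr_sumr.
by apply: eq_bigr => i _; rewrite mxE lift0; ring.
Qed.

Lemma curve_inj : (0 < d)%N -> injective curve.
Proof.
move=> d_gt0 j l /rowP /(_ (Ordinal d_gt0)) /(congr1 Num.norm).
rewrite !mxE !normrM !normr_sign !mul1r !muln1.
rewrite !normrX !(gtr0_norm base_gt0).
by move=> /(ieexprIn base_gt0 (negbT (gt_eqF base_gt1))); lia.
Qed.

Definition staircase_weight (m : nat) (r : nat -> nat) (s : nat -> bool)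
  (i : nat) : R := (-1) ^+ s i / base ^+ breaks m r i.

(** By [breaks_gap], each of the [d] terms outside row [r j] is smaller than the term of that row by
    a factor of at least [base = d + 2], so together they cannot change its sign. *)
Lemma staircase_sign m r s j :
  {homo r : x y / (x <= y)%N} -> (r j <= d)%N -> (j < m)%N ->
  0 < (-1) ^+ (row_sign (r j) j (+) s (r j)) *
    \sum_(i < d.+1) staircase_weight m r s i * (-1) ^+ row_sign i j
                     * base ^+ (j.*2.+1 * i).
Proof.
move=> rmono rd jm; pose t i : R := base ^+ (j.*2.+1 * i) / base ^+ breaks m r i.
have t_gt0 i : 0 < t i by rewrite /t divr_gt0 ?exprn_gt0 ?base_gt0.
have t_le i : i != r j -> t i <= t (r j) / base.
  move=> /(breaks_gap rmono jm) gap; rewrite /t.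
  rewrite ler_pdivlMr ?base_gt0 // mulrAC ler_pdivrMr ?exprn_gt0 ?base_gt0 //.
  rewrite mulrAC ler_pdivlMr ?exprn_gt0 ?base_gt0 // -exprSr -!exprD.
  by rewrite ler_weXn2l ?(ltW base_gt1) // addSn.
pose jr := Ordinal (rd : (r j < d.+1)%N).
rewrite mulr_sumr (bigD1 jr) //= /staircase_weight.
set u := (X in X + _); have -> : u = t (r j).
  by rewrite /u /t signr_addb; case: row_sign (s _) => [] [] /=; ring.
set v := \sum_(i < _ | _) _.
suff : `|v| < t (r j) by rewrite ltr_norml => /andP[]; lra.
apply: le_lt_trans (ler_norm_sum _ _ _) _.
apply: (@le_lt_trans _ _ (\sum_(i < d.+1 | i != jr) t (r j) / base)).
  apply: ler_sum => i ij; rewrite !normrM !normr_sign !mul1r.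
  rewrite mulr1 normfV !normrX (gtr0_norm base_gt0) mulrC; exact: t_le.
rewrite sumr_const cardC1 card_ord /= -mulr_natr mulrAC.
by rewrite ltr_pdivrMr ?base_gt0 // ltr_pM2l ?t_gt0 // ltr_nat.
Qed.


Lemma conv_hull_affine_form_gt0 (S : set 'rV[R]_d) (w : nat -> R) (b : bool) :
  (forall x, S x -> 0 < (-1) ^+ b * affine_form w x) ->
  forall x, conv_hull S x -> 0 < (-1) ^+ b * affine_form w x.
Proof.
move=> hS x /(_ [set y | 0 < (-1) ^+ b * affine_form w y]%classic).
apply; split=> // y z t; rewrite !inE /= => hy hz.
have -> : affine_form w (conv t y z) =
    t%:num * affine_form w y + (1 - t%:num) * affine_form w z.
  rewrite /affine_form !mulrDr !mulr_sumr addrACA -big_split /=; congr (_ + _); first by ring.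
  have -> : conv t y z = t%:num *: y + (1 - t%:num) *: z :> 'rV[R]_d by [].
  by apply: eq_bigr => i _; rewrite !mxE; ring.
rewrite mulrDr mulrCA [X in _ + X]mulrCA.
have t_ge0 : 0 <= t%:num by [].
have t_le1 : t%:num <= 1 by [].
move: t_ge0; rewrite le_eqVlt => /orP[/eqP <-|t_gt0].
  by rewrite mul0r add0r subr0 mul1r.
apply: ltr_pwDl; first exact: mulr_gt0.
by rewrite mulr_ge0 ?subr_ge0 // ltW.
Qed.
End Curve.

(** Tolerance concerns deletions of exactly [k] points, while the set of errors may be smaller. *)
Lemma fset_extend (K : choiceType) (E X : {fset K}) (k : nat) :
  (E `<=` X)%fset -> (#|` E| <= k <= #|` X|)%N ->
  exists S : {fset K}, [/\ (E `<=` S)%fset, (S `<=` X)%fset & #|` S|%fset = k].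
Proof.
move=> EX; elim: k => [|k IH] /andP[Ek kX].
  by exists E; split=> //; apply/eqP; rewrite -leqn0.
move: Ek; rewrite leq_eqVlt => /orP[/eqP Ek|Ek]; first by exists E.
case: IH => [|S [ES SX Sk]]; first by rewrite -ltnS Ek ltnW.
have /fsubsetPn[x xX xS] : ~~ (X `<=` S)%fset.
  by apply/negP => /fsubset_leq_card; rewrite Sk leqNgt kX.
exists (x |` S)%fset; split.
- exact: fsubset_trans ES (fsubsetU1 _ _).
- by rewrite fsubUset fsub1set xX.
- by rewrite cardfsU1 xS Sk.
Qed.

Lemma lambda_spec_lower (R : realType) (d k m : nat) :
  (0 < d)%N -> (2 <= k)%N -> lambda_spec R d k m -> (2 * d + k < m)%N.
Proof.
move=> d_gt0 k_ge2 [km spec]; rewrite ltnNge; apply/negP => m_le.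
pose X := [fset curve R d (nat_of_ord j) | j in 'I_m]%fset.
have Xcard : #|` X|%fset = m.
  rewrite card_imfset ?size_enum_ord //=; last first.
    by move=> i j /(curve_inj d_gt0) /val_inj.
have [A [B [AB_X AB_0 tol]]] := spec X Xcard.
(* The bit [row_sign 0 j] compensates the normalizing factor of [curve]. *)
pose e j := row_sign 0 j (+) (curve R d j \in B).
have [r [s [rmono rd errs]]] := staircase_exists e d.
pose E := [fset curve R d (nat_of_ord j) | j in 'I_m & mismatch e r s j]%fset.
have Ecard : (#|` E| <= k)%N.
  apply: (@leq_trans (\sum_(j < m) mismatch e r s j)%N).
    apply: leq_trans (leq_imfset_card _ _ _) _.
    rewrite -(card_uniqP (enum_finmem_uniq _)) -sum1_card big_mkcond.
    apply: leq_sum => j _; rewrite enum_finmemE !inE /=.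
    by case: mismatch.
  (* At most two errors fall on the first [2 d + 2] times, and at most one on each of the other
     [k - 2]. *)
  apply: (@leq_trans (\sum_(0 <= j < d.*2.+2 + (k - 2)) mismatch e r s j)%N).
    rewrite -(big_mkord xpredT (fun j => mismatch e r s j : nat)).
    by rewrite [leqRHS](@big_cat_nat _ _ _ m) ?leq_addr //=; lia.
  rewrite (@big_cat_nat _ _ _ d.*2.+2) ?leq_addr //= big_mkord.
  rewrite -[leqRHS](subnKC k_ge2) leq_add //.
  apply: leq_trans (_ : \sum_(d.*2.+2 <= j < d.*2.+2 + (k - 2)) 1 <= _)%N.
    by apply: leq_sum => j _; case: mismatch.
  by rewrite sum_nat_const_nat muln1; lia.
have EX : (E `<=` X)%fset.
  by apply/fsubsetP => x /imfsetP[j /= _ ->]; apply/imfsetP; exists j.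
have [|S [ES SX Sk]] := fset_extend EX (k := k); first by rewrite Ecard Xcard.
have [z [zA zB]] := tol S SX Sk.
pose w := staircase_weight R d m r s.
have side x (b : bool) : x \in X -> x \notin S -> (x \in B) = b ->
    0 < (-1) ^+ b * affine_form w x.
  move=> /imfsetP[j /= _ ->] xS xB.
  have mis : mismatch e r s j = false.
    apply: contraNF xS => h; apply: (fsubsetP ES); apply/imfsetP.
    by exists j; rewrite //= inE.
  have := staircase_sign R (j := j) s rmono (rd j) (ltn_ord j).
  rewrite affine_form_curve mulrA -signr_addb.
  congr (0 < (-1) ^+ (nat_of_bool _) * _).
  by move: mis; rewrite /mismatch /e xB; case: row_sign (s _) (row_sign 0 j) b {xB}
    => [] [] [] [].
have hA : 0 < (-1) ^+ false * affine_form w z.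
  apply: conv_hull_affine_form_gt0 zA => x /=; rewrite in_fsetD => /andP[xS xA].
  apply: (side x false) => //; first by rewrite -AB_X in_fsetU xA.
  apply/negbTE/negP => xB.
  have : x \in (A `&` B)%fset by rewrite in_fsetI xA.
  by rewrite AB_0 in_fset0.
have hB : 0 < (-1) ^+ true * affine_form w z.
  apply: conv_hull_affine_form_gt0 zB => x /=; rewrite in_fsetD => /andP[xS xB].
  by apply: (side x true) => //; rewrite -AB_X in_fsetU xB orbT.
move: hA hB; rewrite expr0 expr1; lra.
Qed.

(** * Nearest points of convex hulls *)

Section Dot.
Variables (R : realType) (n : nat).
Implicit Types u v w : 'rV[R]_n.

Definition dot u v : R := \sum_i u 0 i * v 0 i.

Lemma dotC u v : dot u v = dot v u.
Proof. by apply: eq_bigr => i _; rewrite mulrC. Qed.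

Lemma dotDl u v w : dot (u + v) w = dot u w + dot v w.
Proof. by rewrite -big_split; apply: eq_bigr => i _; rewrite mxE mulrDl. Qed.

Lemma dotZl a u v : dot (a *: u) v = a * dot u v.
Proof. by rewrite mulr_sumr; apply: eq_bigr => i _; rewrite mxE mulrA. Qed.

Lemma dotDr u v w : dot u (v + w) = dot u v + dot u w.
Proof. by rewrite dotC dotDl !(dotC u). Qed.

Lemma dotZr a u v : dot u (a *: v) = a * dot u v.
Proof. by rewrite dotC dotZl dotC. Qed.

Lemma dot0r u : dot u 0 = 0.
Proof. by rewrite -(scale0r 0) dotZr mul0r. Qed.

Lemma dot_sumr (I : finType) u (f : I -> 'rV[R]_n) :
  dot u (\sum_i f i) = \sum_i dot u (f i).
Proof.
by elim/big_rec2: _ => [|i x y _ <-]; rewrite ?dot0r // dotDr.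
Qed.

Lemma dot_ge0 u : 0 <= dot u u.
Proof. by apply: sumr_ge0 => i _; rewrite -expr2 sqr_ge0. Qed.

Lemma dot_eq0 u : (dot u u == 0) = (u == 0).
Proof.
apply/eqP/eqP => [h|->]; last exact: dot0r.
apply/rowP => i; rewrite mxE; apply/eqP; rewrite -sqrf_eq0 expr2; apply/eqP.
by apply: (psumr_eq0P _ h) => // j _; rewrite -expr2 sqr_ge0.
Qed.

Lemma segment_shortens p v : dot p v < dot p p ->
  exists t, [/\ 0 <= t, t <= 1 &
    dot ((1 - t) *: p + t *: v) ((1 - t) *: p + t *: v) < dot p p].
Proof.
move=> pv; pose a := dot p p - dot p v.
pose b := dot (v - p) (v - p).
have a_gt0 : 0 < a by rewrite subr_gt0.
have b_ge0 : 0 <= b by apply: dot_ge0.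
have ab_gt0 : 0 < a + b by rewrite ltr_pwDl.
(* The squared length on the segment is [dot p p - t (2 a - t b)]. Adding [a] to the denominator of
   the minimizer [a / b] ensures [t <= 1] and gives [2 a - t b = a + t a > 0]. *)
pose t := a / (a + b).
have t_gt0 : 0 < t by rewrite divr_gt0.
have tab : t * (a + b) = a by rewrite divfK // gt_eqF.
exists t; split; first exact: ltW.
  by rewrite ler_pdivrMr // mul1r lerDl.
have -> : dot ((1 - t) *: p + t *: v) ((1 - t) *: p + t *: v) =
    dot p p - t * (2 * a - t * b).
  rewrite /a /b -(scaleN1r p) !(dotDl, dotDr, dotZl, dotZr) (dotC v p); ring.
rewrite ltrBlDr ltrDl mulr_gt0 //.
have : t * a > 0 by rewrite mulr_gt0.
lra.
Qed.

End Dot.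

Section ConvexCombination.
Variables (R : realType) (n m : nat).
Implicit Types (v : 'I_m -> 'rV[R]_n) (F : {set 'I_m}) (l : 'I_m -> R).

Definition weights F l : Prop :=
  [/\ forall i, 0 <= l i, forall i, i \notin F -> l i = 0 & \sum_i l i = 1].

Definition in_conv v F (p : 'rV[R]_n) : Prop :=
  exists2 l, weights F l & p = \sum_i l i *: v i.

Lemma in_conv_subset v F (G : {set 'I_m}) p :
  F \subset G -> in_conv v F p -> in_conv v G p.
Proof.
move=> FG [l [l0 lF l1] ->]; exists l => //; split=> // i iG.
by apply: lF; apply: contra iG; apply: (fintype.subsetP FG).
Qed.

Lemma in_conv1 v F i : i \in F -> in_conv v F (v i).
Proof.
move=> iF; exists (fun j => (j == i)%:R).
  split=> [j|j jF|]; first exact: ler0n.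
    by case: eqP => // ji; rewrite ji iF in jF.
  by rewrite (bigD1 i) //= eqxx big1 ?addr0 // => j /negPf ->.
by rewrite (bigD1 i) //= eqxx scale1r big1 ?addr0 // => j /negPf ->; rewrite scale0r.
Qed.

Lemma in_conv_segment v F p q t : 0 <= t -> t <= 1 ->
  in_conv v F p -> in_conv v F q -> in_conv v F ((1 - t) *: p + t *: q).
Proof.
move=> t0 t1 [l [l0 lF ls] ->] [l' [l0' lF' ls'] ->].
exists (fun i => (1 - t) * l i + t * l' i).
  split=> [i|i iF|].
  - by rewrite addr_ge0 // mulr_ge0 // subr_ge0.
  - by rewrite lF // lF' // !mulr0 addr0.
  - by rewrite big_split /= -!mulr_sumr ls ls' !mulr1 subrK.
rewrite !scaler_sumr -big_split /=; apply: eq_bigr => i _.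
by rewrite !scalerA -scalerDl.
Qed.

Lemma nearest_point v F : F != finset.set0 ->
  exists2 p, in_conv v F p & forall q, in_conv v F q -> dot p p <= dot q q.
Proof.
move=> /set0Pn[i0 i0F].
(* The minimum is taken over the weights, a box cut by a hyperplane; the side of the box at [i]
   shrinks to 0 for [i] outside [F]. *)
pose A := ([set x : 'rV[R]_m | forall i, `[0, (i \in F)%:R]%classic (x ord0 i)]
  `&` [set x : 'rV[R]_m | \sum_i x ord0 i = 1])%classic.
pose val (x : 'rV[R]_m) := \sum_i x ord0 i *: v i.
have AP x : A x <-> weights F (fun i => x ord0 i).
  split=> [[/= h s]|[l0 lF s]].
    have {}h i : 0 <= x ord0 i <= (i \in F)%:R by move: (h i); rewrite in_itv.
    split=> // i; first by have /andP[] := h i.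
    by move=> /negPf iF; have := h i; rewrite iF -eq_le => /eqP.
  split=> // i /=; rewrite in_itv /= l0 /=; case: (boolP (i \in F)) => iF.
    by rewrite -s (bigD1 i) //= lerDl sumr_ge0.
  by rewrite lF.
have cA : compact A.
  apply: compact_closedI.
    have := @rV_compact R m (fun i => `[0, (i \in F)%:R]%classic).
    by apply=> i; apply: segment_compact.
  apply: (@preimage_closed _ _ (fun x : 'rV[R]_m => \sum_i x ord0 i) [set x | x = 1]%classic).
    move=> x _; apply: continuous_big => [|i _]; first exact: add_continuous.
    exact: coord_continuous.
  exact: closed_eq.
have [c]: exists2 c, c \in A & forall x, x \in A -> dot (val c) (val c) <= dot (val x) (val x).
  apply: (EVT_min_rV (f := fun x => dot (val x) (val x))) => //.
    have [l lw _] := in_conv1 v i0F.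
    exists (\row_i l i); apply/AP.
    by have -> : (fun i => (\row_i l i) ord0 i) = l by apply/funext => i; rewrite mxE.
  apply: continuous_subspaceT.
  have valc (k : 'I_n) : continuous (fun x => val x 0 k).
    have -> : (fun x => val x 0 k) = (fun x => \sum_i x ord0 i * v i 0 k).
      by apply/funext => x; rewrite /val summxE; apply: eq_bigr => i _; rewrite mxE.
    apply: continuous_big => [|i _]; first exact: add_continuous.
    by move=> x; apply: continuousM; [exact: coord_continuous|exact: cst_continuous].
  apply: continuous_big => [|k _]; first exact: add_continuous.
  by move=> x; apply: continuousM; apply: valc.
rewrite inE => /AP cw cmin; exists (val c); first by exists (fun i => c ord0 i).
move=> q [l lw ->]; have -> : \sum_i l i *: v i = val (\row_i l i).
  by apply: eq_bigr => i _; rewrite mxE.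
apply: cmin; rewrite inE; apply/AP.
by have -> : (fun i => (\row_i l i) ord0 i) = l by apply/funext => i; rewrite mxE.
Qed.

Lemma nearest_dot_ge v F p : in_conv v F p ->
  (forall q, in_conv v F q -> dot p p <= dot q q) ->
  forall i, i \in F -> dot p p <= dot p (v i).
Proof.
move=> pF pmin i iF; rewrite leNgt; apply/negP => /segment_shortens[t [t0 t1]].
by rewrite ltNge pmin //; apply: in_conv_segment => //; apply: in_conv1.
Qed.

Lemma linear_dependency v F : (n < #|F|)%N ->
  exists c : 'I_m -> R, [/\ exists i, c i != 0, forall i, i \notin F -> c i = 0
    & \sum_i c i *: v i = 0].
Proof.
move=> nF; pose M := \matrix_(i < #|F|) v (enum_val i).
have [i ci] : exists i, row i (kermx M) != 0.
  apply/existsP; rewrite -negb_forall; apply/negP => /forallP h.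
  have : kermx M = 0 by apply/row_matrixP => i; rewrite row0; apply/eqP.
  move/eqP; rewrite kermx_eq0 /row_free => /eqP rM.
  by have := rank_leq_col M; rewrite rM leqNgt nF.
pose x := row i (kermx M).
have xM : x *m M = 0 by rewrite /x -row_mul mulmx_ker row0.
pose c j := \sum_(a < #|F| | enum_val a == j) x 0 a.
have cE a : c (enum_val a) = x 0 a.
  by rewrite /c (big_pred1 a) // => b; rewrite /= (inj_eq enum_val_inj).
have cF j : j \notin F -> c j = 0.
  by move=> jF; rewrite /c big1 // => a /eqP aj; rewrite -aj enum_valP in jF.
exists c; split=> //.
  have [a xa] : exists a, x 0 a != 0.
    apply/existsP; rewrite -negb_forall; apply: contra ci => /forallP h.
    by apply/eqP/rowP => a; rewrite [RHS]mxE; apply/eqP.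
  by exists (enum_val a); rewrite cE.
rewrite (bigID (mem F)) /= [X in _ + X]big1 ?addr0; last first.
  by move=> j jF; rewrite cF // scale0r.
rewrite big_enum_val /= -[RHS]xM; apply/rowP => j; rewrite summxE mxE.
by apply: eq_bigr => a _; rewrite [LHS]mxE cE [M a j]mxE.
Qed.

(** Vectors of positive weight lie on the hyperplane [dot p x = dot p p], which avoids 0. A linear
    dependency among them thus has coefficient sum 0, so that [n + 1] of them, not [n + 2], already
    allow one to be removed. *)
Lemma nearest_caratheodory v F p : in_conv v F p -> 0 < dot p p ->
  (forall q, in_conv v F q -> dot p p <= dot q q) ->
  exists T : {set 'I_m}, [/\ (#|T| <= n)%N, T \subset F & in_conv v T p].
Proof.
move=> pF p_gt0 pmin.
have [s] := ubnP #|F|; move: pF pmin; elim: s => // s IH in F *.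
move=> pF pmin; rewrite ltnS => Fs.
have [?|nF] := leqP #|F| n; first by exists F.
case: (pF) => l [l0 lF l1] pE.
have shrink (T : {set 'I_m}) : T \proper F -> in_conv v T p ->
    exists T : {set 'I_m}, [/\ (#|T| <= n)%N, T \subset F & in_conv v T p].
  move=> TF pT; have [||T' [? T'T ?]] := IH T pT.
  - by move=> q qT; apply: pmin; apply: in_conv_subset qT; apply: fintype.proper_sub.
  - by apply: leq_trans Fs; apply: proper_card.
  by exists T'; split=> //; apply: fintype.subset_trans T'T (fintype.proper_sub TF).
have [[i iF li]|posF] := pselect (exists2 i, i \in F & l i = 0).
  apply: (shrink (F :\ i)); first by rewrite properD1.
  exists l => //; split=> // j; rewrite !inE negb_and negbK.
  by case/orP => [/eqP ->|/lF].
have dotF i : i \in F -> dot p (v i) = dot p p.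
  have ge0 j : 0 <= l j * (dot p (v j) - dot p p).
    have [jF|/lF ->] := boolP (j \in F); last by rewrite mul0r.
    by rewrite mulr_ge0 // subr_ge0 (nearest_dot_ge pF pmin).
  have sum0 : \sum_j l j * (dot p (v j) - dot p p) = 0.
    under eq_bigr do rewrite mulrBr.
    rewrite sumrB -mulr_suml l1 mul1r {3}pE dot_sumr.
    by apply/eqP; rewrite subr_eq0; apply/eqP/eq_bigr => j _; rewrite dotZr.
  move=> iF; have /(_ i isT) /eqP := psumr_eq0P (fun j _ => ge0 j) sum0.
  rewrite mulf_eq0 subr_eq0 => /orP[/eqP li|/eqP //].
  by case: posF; exists i.
have [c [[i0 ci0] cF cv]] := linear_dependency v nF.
have csum : \sum_i c i = 0.
  have : dot p (\sum_i c i *: v i) = 0 by rewrite cv dot0r.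
  rewrite dot_sumr (eq_bigr (fun i => c i * dot p p)) -?mulr_suml.
    by move/eqP; rewrite mulf_eq0 (gt_eqF p_gt0) orbF => /eqP.
  move=> i _; rewrite dotZr; have [iF|/cF ->] := boolP (i \in F); last by rewrite !mul0r.
  by rewrite dotF.
have [j0 cj0] : exists j, 0 < c j.
  apply/existsP; rewrite -[X in is_true X]negbK negb_exists; apply/negP => /forallP h.
  have h' i : true -> 0 <= - c i by rewrite oppr_ge0 leNgt.
  have := psumr_eq0P h'; rewrite sumrN csum oppr0 => /(_ erefl) /(_ i0 isT) /eqP.
  by rewrite oppr_eq0 (negPf ci0).
(* The weight at [j1] is the first to vanish when a multiple of [c] is subtracted from [l]. *)
pose j1 := [arg min_(j < j0 | 0 < c j) (l j / c j)]%O.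
have [cj1 jmin] : 0 < c j1 /\ forall j, 0 < c j -> l j1 / c j1 <= l j / c j.
  by rewrite /j1; case: arg_minP => // j ? h; split.
pose t := l j1 / c j1.
have t_ge0 : 0 <= t by rewrite divr_ge0 // ltW.
have j1F : j1 \in F by apply: contraLR cj1 => /cF ->; rewrite ltxx.
apply: (shrink (F :\ j1)); first by rewrite properD1.
exists (fun i => l i - t * c i); last first.
  transitivity (\sum_i l i *: v i - t *: \sum_i c i *: v i).
    by rewrite cv scaler0 subr0.
  rewrite scaler_sumr -sumrB.
  by apply: eq_bigr => i _; rewrite scalerBl scalerA.
split.
- move=> i; rewrite subr_ge0; have [ci|ci] := ltP 0 (c i).
    by rewrite -ler_pdivlMr // jmin.
  by apply: le_trans (l0 i); rewrite mulr_ge0_le0.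
- move=> i; rewrite !inE negb_and negbK => /orP[/eqP ->|iF].
    by rewrite /t divfK ?subrr // gt_eqF.
  by rewrite lF // cF // mulr0 subr0.
- by rewrite sumrB l1 -mulr_sumr csum mulr0 subr0.
Qed.

End ConvexCombination.

(** * Tolerant signs and the upper bound *)

Section Signs.
Variables (R : realType) (n m : nat) (y : 'I_m -> 'rV[R]_n).
Implicit Types (e : {ffun 'I_m -> bool}) (J S T : {set 'I_m}).

Definition signed e (i : 'I_m) : 'rV[R]_n := (-1) ^+ e i *: y i.

(** The signs are those of the coefficients of a linear dependency, the weights their normalized
    absolute values. *)
Lemma radon_signs J : (n < #|J|)%N -> exists e, in_conv (signed e) J 0.
Proof.
move=> /(linear_dependency y)[c [[i0 ci0] cJ cy]].
pose s := \sum_i `|c i|.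
have s_gt0 : 0 < s.
  rewrite /s (bigD1 i0) //=; apply: ltr_pwDl; first by rewrite normr_gt0.
  by apply: sumr_ge0 => i _; apply: normr_ge0.
exists [ffun i => c i < 0]; exists (fun i => `|c i| / s).
  split=> [i|i /cJ ->|]; first by rewrite divr_ge0 // ltW.
    by rewrite normr0 mul0r.
  by rewrite -mulr_suml divff // gt_eqF.
transitivity (s^-1 *: \sum_i c i *: y i); first by rewrite cy scaler0.
rewrite scaler_sumr; apply: eq_bigr => i _.
rewrite /signed ffunE !scalerA {1}[c i]numEsign mulrAC; congr (_ *: _); ring.
Qed.

(* Suppose every choice of signs admits a deletion separating 0 from the hull
   of the rest, and take signs for which the resulting distance is minimal.
   The point p realizing it lies in the hull of at most n vectors; re-sign the
   remaining ones by the induction hypothesis, and flip all of them if needed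
   so that more than k lie in the half-space opposite to p.  A deletion hitting
   the n vectors leaves 0 in the hull; any other one leaves p and a vector
   opposite to it, so that the distance strictly decreases. *)
Lemma tolerant_signs k J : (2 <= n)%N -> (k.+1 * n < #|J|)%N ->
  exists e, forall S, (#|S| <= k)%N -> in_conv (signed e) (J :\: S) 0.
Proof.
move=> n_ge2; elim: k J => [|k IH] J Jcard.
  have [e eJ] : exists e, in_conv (signed e) J 0 by apply: radon_signs; lia.
  by exists e => S; rewrite leqn0 cards_eq0 => /eqP ->; rewrite finset.setD0.
apply: contrapT => none.
have nonempty S : (#|S| <= k.+1)%N -> J :\: S != finset.set0.
  move=> Sk; rewrite finset.setD_eq0; apply/negP => /subset_leq_card; nia.
have bad e : exists Sp : {set 'I_m} * 'rV[R]_n,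
  [/\ (#|Sp.1| <= k.+1)%N, in_conv (signed e) (J :\: Sp.1) Sp.2,
      forall q, in_conv (signed e) (J :\: Sp.1) q -> dot Sp.2 Sp.2 <= dot q q
    & 0 < dot Sp.2 Sp.2].
  apply: contrapT => noS; apply: none; exists e => S Sk; apply: contrapT => S0.
  have [p pS pmin] := nearest_point (signed e) (nonempty _ Sk).
  apply: noS; exists (S, p); split=> //=.
  rewrite lt_neqAle dot_ge0 andbT eq_sym dot_eq0; apply/negP => /eqP p0.
  by rewrite p0 in pS.
have [w wP] := choice bad.
pose e := [arg min_(e < [ffun=> false]) dot (w e).2 (w e).2]%O.
have emin e' : dot (w e).2 (w e).2 <= dot (w e').2 (w e').2.
  by rewrite /e; case: arg_minP => // e1 _; apply.
move: (wP e); case: (w e) emin => S p /= emin [Sk pS pmin p_gt0].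
have [T [Tn TS pT]] := nearest_caratheodory pS p_gt0 pmin.
pose Q := J :\: T.
have Qcard : (k.+1 * n < #|Q|)%N.
  have := cardsID T J; have : (#|J :&: T| <= n)%N.
    by apply: leq_trans Tn; apply: subset_leq_card; apply: subsetIr.
  by rewrite -/Q; lia.
have [e1 e1P] := IH Q Qcard.
pose low (b : bool) := [set i in Q | (-1) ^+ b * dot p (signed e1 i) <= 0].
(* Every vector of [Q] is low for some [b], and [n >= 2] gives [Q] more than [2 (k + 1)]
   elements. *)
have [b lowb] : exists b, (k.+1 < #|low b|)%N.
  have : (#|Q| <= #|low false| + #|low true|)%N.
    have <- : low false :|: low true = Q.
      apply/finset.setP => i; rewrite !inE -andb_orr expr0 expr1 mul1r mulN1r oppr_le0.
      by rewrite le_total andbT.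
    by rewrite leq_card_setU.
  have [?|?] := ltnP k.+1 #|low false|; first by exists false.
  by exists true; nia.
pose e2 : {ffun 'I_m -> bool} := [ffun i => if i \in T then e i else e1 i (+) b].
have e2T i : i \in T -> signed e2 i = signed e i.
  by move=> iT; rewrite /signed ffunE iT.
have e2Q i : i \in Q -> signed e2 i = (-1) ^+ b *: signed e1 i.
  by rewrite inE => /andP[/negPf iT _]; rewrite /signed ffunE iT scalerA -signr_addb addbC.
have [S2k _ q2min _] := wP e2.
suff [q qJ] : exists2 q, in_conv (signed e2) (J :\: (w e2).1) q & dot q q < dot p p.
  by rewrite ltNge (le_trans (emin e2)) // q2min.
move: ((w e2).1) S2k => S2 S2k {q2min}.
have [S2T|] := boolP [disjoint S2 & T]; last first.
  rewrite -setI_eq0 => /set0Pn[i]; rewrite inE => /andP[iS2 iT].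
  exists 0; last by rewrite dot0r.
  (* As [S2] meets [T], at most [k] of its elements lie outside [T]; the common flip by [b] fixes
     0. *)
  have [|l [l0 lF l1] lE] := e1P (S2 :\: T).
    rewrite -ltnS; apply: leq_trans S2k; apply: proper_card.
    apply/properP; split; first exact: subsetDl.
    by exists i => //; rewrite inE iT.
  exists l.
    split=> // j jJ; apply: lF; apply: contra jJ; rewrite !inE.
    by case: (j \in T); case: (j \in S2); case: (j \in J).
  transitivity ((-1) ^+ b *: \sum_j l j *: signed e1 j); first by rewrite -lE scaler0.
  rewrite scaler_sumr; apply: eq_bigr => j _.
  have [jQ|jQ] := boolP (j \in Q); first by rewrite scalerA mulrC -scalerA e2Q.
  by rewrite lF ?scale0r ?scaler0 // inE negb_and jQ orbT.
have [i ilow iS2] : exists2 i, i \in low b & i \notin S2.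
  apply/subsetPn; apply/negP => /subset_leq_card; lia.
move: ilow; rewrite inE => /andP[iQ ip].
have [|t [t0 t1 tlt]] := @segment_shortens _ _ p (signed e2 i).
  by rewrite e2Q // dotZr (le_lt_trans ip).
exists ((1 - t) *: p + t *: signed e2 i) => //; apply: in_conv_segment => //.
  case: pT => l [l0 lT l1] pE; exists l.
    split=> // j jJ; apply: lT; apply: contra jJ => jT.
    rewrite inE (disjointFl S2T jT) /=.
    by move/fintype.subsetP/(_ j jT): TS; rewrite inE => /andP[].
  rewrite pE; apply: eq_bigr => j _; have [jT|/lT ->] := boolP (j \in T).
    by rewrite e2T.
  by rewrite !scale0r.
by apply: in_conv1; rewrite inE iS2 /=; move: iQ; rewrite inE => /andP[].
Qed.

End Signs.

(** * From signs back to partitions *)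

(** Convexity only provides binary combinations, so points are added one at a time to renormalized
    partial sums, as soon as the partial weight is positive. *)
Lemma conv_hull_sum (R : realType) (d : nat) (X : set 'rV[R]_d) (m : nat)
    (x : 'I_m -> 'rV[R]_d) (l : 'I_m -> R) :
  (forall i, 0 <= l i) -> \sum_i l i = 1 -> (forall i, l i != 0 -> X (x i)) ->
  conv_hull X (\sum_i l i *: x i).
Proof.
move=> l0 l1 lX C [Cconv XC].
suff scaled r : 0 < \sum_(i <- r) l i ->
    C ((\sum_(i <- r) l i)^-1 *: \sum_(i <- r) l i *: x i).
  by have := scaled (index_enum 'I_m); rewrite l1 invr1 scale1r; apply.
elim: r => [|i r IH]; first by rewrite big_nil ltxx.
rewrite !big_cons; set s := \sum_(j <- r) l j; set u := \sum_(j <- r) _.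
have s_ge0 : 0 <= s by apply: sumr_ge0.
have [->|li0] := eqVneq (l i) 0; first by rewrite scale0r !add0r.
move=> ls_gt0; have [s0|s_neq0] := eqVneq s 0.
  have -> : u = 0.
    apply: big1_seq => j jr; have /eqP := s0; rewrite psumr_eq0 // => /allP/(_ j jr).
    by move=> /eqP ->; rewrite scale0r.
  by rewrite s0 !addr0 scalerA mulVf // scale1r; apply/XC/lX.
have s_gt0 : 0 < s by rewrite lt_neqAle eq_sym s_neq0.
have t01 : 0 <= l i / (l i + s) <= 1.
  by rewrite divr_ge0 ?(ltW ls_gt0) //= ler_pdivrMr // mul1r lerDl.
pose t : {i01 R} := Itv01 (proj1 (andP t01)) (proj2 (andP t01)).
have := Cconv (x i) (s^-1 *: u) t; rewrite !inE => /(_ (XC _ (lX i li0)) (IH s_gt0)).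
congr (C _).
transitivity ((l i / (l i + s)) *: x i +
  (1 - l i / (l i + s)) *: (s^-1 *: u) : 'rV[R]_d); first by [].
rewrite scalerDr !scalerA; congr (_ *: _ + _ *: _); first by rewrite mulrC.
by field; rewrite s_neq0 gt_eqF.
Qed.

(** The number of points is [(k + 1) (1 + d) + 1], as [tolerant_signs] requires for the lifts in
    dimension [1 + d]. *)
Lemma lambda_spec_upper (R : realType) (d k : nat) : (0 < d)%N ->
  lambda_spec R d k ((k + 1) * d + (k + 2)).
Proof.
move=> d_gt0; split; first by lia.
move=> X Xcard; set m := ((k + 1) * d + (k + 2))%N in Xcard.
pose x (i : 'I_m) : 'rV[R]_d := nth 0 X i.
have xX i : x i \in X by rewrite mem_nth // -[size _]/(#|` X|) Xcard.
have x_inj : injective x.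
  move=> i j /eqP; rewrite nth_uniq ?fset_uniq // -?[size _]/(#|` X|) ?Xcard //.
  by move/eqP/val_inj.
pose y (i : 'I_m) : 'rV[R]_(1 + d) := row_mx 1 (x i).
have [||e eP] := tolerant_signs y (k := k) (J := [set: 'I_m]%SET).
- by lia.
- by rewrite cardsT card_ord /m; lia.
pose part b := [fset x i | i in 'I_m & e i == b]%fset.
exists (part false), (part true); split.
- apply/fsetP => z; rewrite in_fsetU; apply/orP/idP.
    by case=> /imfsetP[i /= _ ->].
  move=> zX; have iz : (index z X < m)%N by rewrite -Xcard index_mem.
  have -> : z = x (Ordinal iz) by rewrite /x nth_index.
  case ei: (e (Ordinal iz)); [right|left]; apply/imfsetP; exists (Ordinal iz) => //=;
    by rewrite inE ei.
- apply/fsetP => z; rewrite in_fsetI in_fset0; apply/andP => -[].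
  move=> /imfsetP[i /=]; rewrite inE => /eqP ei -> /imfsetP[j /=].
  by rewrite inE => /eqP ej /x_inj ij; rewrite ij ej in ei.
- move=> S SX Sk.
  have [|l [l0 lF l1] lE] := eP [set i | x i \in S].
    rewrite cardE -(size_map x) -Sk; apply: uniq_leq_size.
      by rewrite map_inj_uniq ?enum_uniq.
    by move=> z /mapP[i]; rewrite mem_enum inE => xS ->.
  have lS i : l i != 0 -> x i \notin S.
    by apply: contra => xS; rewrite lF // !inE xS.
  (* The constant coordinate of the lift shows that both parts carry equal weight, hence [1 / 2]
     each; this explains the factor 2 in [q]. *)
  have balance : \sum_i (if e i == false then l i else 0) =
      \sum_i (if e i == true then l i else 0).
    apply/eqP; rewrite -subr_eq0 -sumrB; apply/eqP.
    have /rowP/(_ (lshift d 0)) := lE; rewrite summxE mxE => h.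
    apply: etrans (esym h); apply: eq_bigr => i _; rewrite !mxE (unsplitK (inl _)) mxE eqxx.
    by case: (e i); rewrite /=; ring.
  have key b : \sum_i (if e i == b then l i else 0) = 1 / 2.
    have : \sum_i (if e i == false then l i else 0) +
      \sum_i (if e i == true then l i else 0) = 1.
      by rewrite -big_split -l1; apply: eq_bigr => i _; case: (e i); rewrite /= ?addr0 ?add0r.
    by case: b; lra.
  have keyx : \sum_i (if e i == false then l i else 0) *: x i =
     \sum_i (if e i == true then l i else 0) *: x i.
    apply/eqP; rewrite -subr_eq0 -sumrB; apply/eqP/rowP => j.
    have /rowP/(_ (rshift 1 j)) := lE; rewrite !summxE !mxE => h.
    apply: etrans (esym h); apply: eq_bigr => i _; rewrite !mxE (unsplitK (inr _)).
    by case: (e i); rewrite /=; ring.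
  pose q b := \sum_i (2 * if e i == b then l i else 0) *: x i.
  have qP b : conv_hull [set` (part b `\` S)%fset] (q b).
    apply: conv_hull_sum => [i||i].
    - by case: ifP; rewrite ?mulr0 // mulr_ge0.
    - by rewrite -mulr_sumr key mulrC divfK.
    case: ifP => ei; last by rewrite mulr0 eqxx.
    rewrite mulf_eq0 negb_or => /andP[_ /lS xS] /=.
    by rewrite in_fsetD xS; apply/imfsetP; exists i.
  exists (q false); split; first exact: qP.
  suff -> : q false = q true by apply: qP.
  rewrite /q; under eq_bigr do rewrite -scalerA.
  by rewrite -scaler_sumr keyx scaler_sumr; apply: eq_bigr => i _; rewrite scalerA.
Qed.

Theorem theorem2 (R : realType) (d k : nat) (k_ge2 : (2 <= k)%N)
    (k_le : (k <= d %/ 2)%N) :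
  (2 * d + k + 1 <= lambda R d k <= (k + 1) * d + (k + 2))%N.
Proof.
have d_gt0 : (0 < d)%N by case: d k_le => // /(leq_trans k_ge2).
have upper := lambda_spec_upper R k d_gt0.
have [n nP nmin] : exists2 n, lambda_spec R d k n &
    forall m, lambda_spec R d k m -> (n <= m)%N.
  have ex : exists n, `[< lambda_spec R d k n >] by eexists; apply/asboolP/upper.
  case: (ex_minnP ex) => n /asboolP nP nmin; exists n => // m mP.
  by apply: nmin; apply/asboolP.
(* The default of [xget] is ruled out by the minimum [n]. *)
rewrite /lambda; case: xgetP => [m _ [mP mmin]|/(_ n) []]; last by split.
by rewrite addn1 (lambda_spec_lower d_gt0 k_ge2 mP) mmin.
Qed.
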